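(* Let $A$ be an $(n-2)\times n$ integer matrix of rank $n-2$ whose row space over $\mathbb{Q}$ contains $(1,\dots,1)$, so that $X_A\subset\mathbb{P}^{n-1}$ is a projective toric variety of codimension $2$, let $B$ be a Gale dual of $A$ with rows $b_1,\dots,b_n$, all nonzero, and let $P=\mathrm{Conv}(A)$. Let $\beta\subset\alpha$ be proper faces of $P$. Then $$\mu(\alpha,\beta)=1\qquad\text{and}\qquad i(\alpha,\beta)=1$$ if any of the following conditions holds: (i) not all rows of $B_\alpha$ are contained in a (single) relevant line; (ii) all rows of $B_\beta$ are contained in the same relevant line.
   Context: Notation. The columns of $A$ are $a_1,\dots,a_n\in\mathbb{Z}^{d}$, $d=n-2$; $P=\mathrm{Conv}(A)$ is the convex hull of the columns. $X_A\subset\mathbb{P}^{n-1}$ is the closure of the image of the monomial map $t\mapsto(t^{a_1}:\cdots:t^{a_n})$, $t\in(\mathbb{C}^* )^d$. A Gale dual of $A$ is an $n\times 2$ integer matrix $B$ whose columns form a $\mathbb{Z}$-basis of the kernel of $A:\mathbb{Z}^n\to\mathbb{Z}^{d}$ (image of $B$ equals kernel of $A$). Its rows are $b_1,\dots,b_n\in\mathbb{Z}^2$. Faces are understood to be nonempty. For a face $\alpha$ of $P$: $A_\alpha$ is the collection of columns $a_i$ of $A$ lying on $\alpha$; $B_\alpha$ is the collection (or matrix) of rows $b_i$ with $a_i\notin\alpha$. $\mathbb{Z}\alpha$ is the subgroup of $\mathbb{Z}^d$ generated by $A_\alpha$, and $\mathbb{R}\alpha$ is the linear subspace of $\mathbb{R}^d$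 spanned by $\alpha$. A line through $0$ in $\mathbb{R}^2$ is a relevant line if it contains two of the rows $b_r,b_s$ of $B$ pointing in opposite directions. For faces $\beta\subset\alpha$ of $P$: $i(\alpha,\beta)$ is the index $[\mathbb{Z}\alpha\cap\mathbb{R}\beta:\mathbb{Z}\beta]$. The relative normalized subdiagram volume is $$\mu(\alpha,\beta)=\mathrm{Vol}(\mathrm{Conv}(A_\alpha/\beta))-\mathrm{Vol}(\mathrm{Conv}((A_\alpha/\beta)\setminus\{0\})),$$ where $A_\alpha/\beta$ is the image of $A_\alpha$ in the quotient lattice $\mathbb{Z}\alpha/(\mathbb{Z}\alpha\cap\mathbb{R}\beta)$, which has rank $\dim\alpha-\dim\beta$, and $\mathrm{Vol}$ is the $(\dim\alpha-\dim\beta)$-dimensional volume normalized with respect to this quotient lattice (a unimodular simplex has volume $1$; the volume of a lower-dimensional or empty polytope is $0$, while a point in rank $0$ has volume $1$). *)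

(* Defs.v *)
From HB Require Import structures.
From mathcomp Require Import all_boot all_order all_algebra finmap.
From mathcomp Require Import mathcomp_extra boolp classical_sets functions.
From mathcomp Require Import cardinality reals ereal topology normedtype.
From mathcomp Require Import measure lebesgue_measure numfun lebesgue_integral.
From mathcomp Require Import convex.

Set Implicit Arguments.
Unset Strict Implicit.
Unset Printing Implicit Defensive.

Import Order.TTheory GRing.Theory Num.Theory.

Local Open Scope classical_set_scope.
Local Open Scope ring_scope.

Definition intmxR (R : realType) (m n : nat) (M : 'M[int]_(m, n)) : 'M[R]_(m, n) :=
  map_mx intr M.

Arguments intmxR R {m n} M.

(** ** Subgroups, linear spans and convex hulls of sets *)

Definition subgroup_span (V : zmodType) (S : set V) : set V :=
  smallest (fun H : set V => zmod_closed (mem H)) S.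

Definition linear_span (R : realType) (V : lmodType R) (S : set V) : set V :=
  smallest (fun H : set V => submod_closed (mem H)) S.

Definition convex_hull (R : realType) (V : lmodType R) (S : set V) : set V :=
  smallest (@convex_set R V) S.

(** The index [G : H] of a subgroup [H] of [G], as the number of cosets of [H]
    in [G]; it is [0] when there are infinitely many. *)
Definition subgroup_index (V : zmodType) (G H : set V) : nat :=
  let cosets : set (set V) := [set [set x + y | y in H] | x in G] in
  #|` fset_set cosets |%fset.

(** ** Dimension and faces *)

Definition affinely_independent (R : realType) (d m : nat)
    (x : 'I_m -> 'cV[R]_d) : Prop :=
  forall c : 'I_m -> R,
    \sum_i c i = 0 -> \sum_i c i *: x i = 0 -> forall i, c i = 0.

(** The dimension of the affine hull of a nonempty set. *)
Definition affine_dim (R : realType) (d : nat) (S : set 'cV[R]_d) : nat :=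
  \max_(m < d.+1 | `[< exists x : 'I_m.+1 -> 'cV[R]_d,
                        (forall i, S (x i)) /\ affinely_independent x >]) m.

(** [u = 0] is allowed, so that [P] is a face of itself. *)
Definition face (R : realType) (d : nat) (P F : set 'cV[R]_d) : Prop :=
  F !=set0 /\
  exists (u : 'rV[R]_d) (c : R),
    (forall x, P x -> (u *m x) 0 0 <= c) /\
    F = [set x | P x /\ (u *m x) 0 0 = c].

Definition proper_face (R : realType) (d : nat) (P F : set 'cV[R]_d) : Prop :=
  face P F /\ F <> P.

(** ** Volumes *)

(** Lebesgue measure on [R^k], as the [k]-fold product of the Lebesgue measure
    on the line: the measure of [S] is the integral over [x] of the measure of
    the section of [S] at first coordinate [x] (cf. [product_measure1]).  On
    [R^0] it is the unit mass at the unique point. *)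
Fixpoint lebesgue_vol (R : realType) (k : nat) : set 'cV[R]_k -> \bar R :=
  match k return set 'cV[R]_k -> \bar R with
  | 0 => fun S => (\1_S (0 : 'cV[R]_0))%:E
  | k'.+1 => fun S =>
      (\int[@lebesgue_measure R]_x
         lebesgue_vol [set y : 'cV[R]_k' | S (col_mx (x%:M : 'cV[R]_1) y)])%E
  end.

(** [Vol (Conv S)], normalized with respect to the lattice [Z^k]: the standard
    simplex, of Lebesgue measure [1 / k`!], has volume [1]. *)
Definition normalized_vol (R : realType) (k : nat) (S : set 'cV[int]_k) : \bar R :=
  (k`!%:R%:E * lebesgue_vol (convex_hull (intmxR R @` S)))%E.

(** [phi] restricted to [G] is a group morphism onto [Z^k] with kernel [H],
    i.e. it induces an isomorphism [G / H -> Z^k]. *)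
Definition quotient_chart (V : zmodType) (G H : set V) (k : nat)
    (phi : V -> 'cV[int]_k) : Prop :=
  [/\ {in G &, forall x y, phi (x + y) = phi x + phi y},
      phi @` G = setT &
      G `&` phi @^-1` [set 0] = H].

(** ** Toric data *)

Section ToricData.
Variables (R : realType) (d n : nat).
Implicit Types (A : 'M[int]_(d, n)) (B : 'M[int]_(n, 2)).
Implicit Types (alpha beta : set 'cV[R]_d).

(** The columns of [B] form a Z-basis of the kernel of [A : Z^n -> Z^d]. *)
Definition gale_dual A B : Prop :=
  A *m B = 0 /\
  forall v : 'cV[int]_n, A *m v = 0 -> exists! c : 'cV[int]_2, v = B *m c.

Definition Conv A : set 'cV[R]_d :=
  convex_hull [set intmxR R (col i A) | i in [set: 'I_n]].

Definition lies_on A alpha (i : 'I_n) : Prop := alpha (intmxR R (col i A)).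

Definition columns_on A alpha : set 'cV[int]_d :=
  [set col i A | i in lies_on A alpha].

Definition rows_off A B alpha : set 'rV[int]_2 :=
  [set row i B | i in ~` lies_on A alpha].

Definition line_through0 (L : set 'rV[R]_2) : Prop :=
  exists2 v : 'rV[R]_2, v != 0 & L = [set t *: v | t in [set: R]].

Definition opposite_directions (u v : 'rV[R]_2) : Prop :=
  u != 0 /\ exists2 t : R, 0 < t & v = - (t *: u).

Definition relevant_line B (L : set 'rV[R]_2) : Prop :=
  line_through0 L /\
  exists r s : 'I_n,
    [/\ L (intmxR R (row r B)), L (intmxR R (row s B)) &
        opposite_directions (intmxR R (row r B)) (intmxR R (row s B))].

(** [Z alpha] *)
Definition face_lattice A alpha : set 'cV[int]_d :=
  subgroup_span (columns_on A alpha).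

(** [Z alpha] intersected with the real span of [beta] *)
Definition face_lattice_in_span A alpha beta : set 'cV[int]_d :=
  face_lattice A alpha `&` intmxR R @^-1` linear_span beta.

(** [i(alpha, beta)] *)
Definition face_index A alpha beta : nat :=
  subgroup_index (face_lattice_in_span A alpha beta) (face_lattice A beta).

(** [mu(alpha, beta)].  The quotient lattice is identified with [Z^k] by an
    arbitrary isomorphism; the volumes do not depend on this choice, as two
    choices differ by an element of [GL_k(Z)]. *)
Definition subdiagram_vol A alpha beta : \bar R :=
  let k := (affine_dim alpha - affine_dim beta)%N in
  let phi : 'cV[int]_d -> 'cV[int]_k := xget (fun=> 0)
    [set phi : 'cV[int]_d -> 'cV[int]_k |
      quotient_chart (face_lattice A alpha)
                     (face_lattice_in_span A alpha beta) phi] in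
  let A_alpha_beta : set 'cV[int]_k := phi @` columns_on A alpha in
  (normalized_vol R A_alpha_beta - normalized_vol R (A_alpha_beta `\ 0%R))%E.

End ToricData.

Arguments Conv R {d n} A.

(* Main.v *)
Require Import Defs.
From mathcomp Require Import all_boot all_order all_algebra finmap.
From mathcomp Require Import boolp classical_sets cardinality reals ereal.
From mathcomp Require Import topology normedtype sequences realfun.
From mathcomp Require Import measure measurable_realfun lebesgue_measure numfun.
From mathcomp Require Import lebesgue_integral ring lra zify.

(** Everything follows from one linear fact: under either condition, a relation
    among the columns of [A] lying on [alpha] only involves columns lying on
    [beta] ([gale_relations_on_subface]).

    By Gale duality a relation is [B c] for some [c] in the plane, and its
    coefficient at [i] is the product of the row [b_i] with [c]; it is
    supported on [alpha] when [c] is orthogonal to the rows of [B_alpha].  A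
    functional exposing [alpha] gives a relation with positive coefficients
    between the rows of [B_alpha]
    ([proper_face_positive_relation]).  Hence, if these rows lie on one line,
    two of them are opposite and the line is relevant.  So condition (i) forces
    [c = 0].  Under condition (ii) the rows of [B_beta] are all multiples of
    any one row of [B_alpha], none being zero, so they are orthogonal to [c]
    as soon as that row is, and [B c] vanishes off [beta].

    Given this fact, the [k] columns on [alpha] off [beta] are linearly
    independent modulo the span of [beta].  So [Z alpha] meets the span of
    [beta] in [Z beta], the index is [1] ([face_index1]), the dimension grows
    by exactly [k] from [beta] to [alpha] ([affine_dim_diff]), and these
    columns map to a basis of the quotient lattice, while those on [beta] map
    to [0].  In any chart [Z^k] of the quotient, the image of the columns is
    therefore [0] together with the columns of a unimodular matrix
    ([chart_image]), and [mu] is the volume of a unimodular simplex minus that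
    of its facet opposite to [0].

    The value [1 - 0] of this difference is obtained by counting lattice
    points, which avoids a change of variables in the iterated integral.  The
    cells [floor (N x) = p] have volume [N ^ - k], so the volume of a set is
    squeezed between cell counts ([le_lebesgue_vol], [lebesgue_vol_cells]).
    The unimodular matrix permutes [Z^k], so the cells in question are counted
    by the integer points of a standard simplex of size [N + O(1)], of which
    there are [binomial (N + O(1)) k], asymptotic to [N ^ k / k`!]. *)

Set Implicit Arguments.
Unset Strict Implicit.
Unset Printing Implicit Defensive.

Import Order.TTheory GRing.Theory Num.Theory.
Import numFieldNormedType.Exports.
Local Open Scope classical_set_scope.
Local Open Scope ring_scope.

(** * Volume of unions of grid cells *)

(** The integral of a nonnegative function is a supremum over the simple
    functions below it, so it is monotone without any measurability; this
    matters because sections of arbitrary sets are integrated. *)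
Lemma ge0_integral_mono d (T : measurableType d) (R : realType)
    (mu : {measure set T -> \bar R}) (f g : T -> \bar R) :
  (forall x, 0 <= f x)%E -> (forall x, f x <= g x)%E ->
  (\int[mu]_x f x <= \int[mu]_x g x)%E.
Proof.
move=> f0 fg; rewrite !ge0_integralTE//; last first.
  by move=> x; apply: le_trans (fg x).
apply: ereal_sup_le => _ [h /= hf <-].
by exists h => //= x; apply: le_trans (fg x).
Qed.

Section Volume.
Variable R : realType.

Lemma lebesgue_vol_ge0 k (S : set 'cV[R]_k) : (0 <= lebesgue_vol S)%E.
Proof.
elim: k S => [|k IH] S /=; first by rewrite lee_fin.
by apply: integral_ge0 => x _; exact: IH.
Qed.

Lemma le_lebesgue_vol k (S T : set 'cV[R]_k) :
  S `<=` T -> (lebesgue_vol S <= lebesgue_vol T)%E.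
Proof.
elim: k S T => [|k IH] S T ST /=.
  rewrite lee_fin !indicE ler_nat.
  case: (boolP (0 \in S)) => // /set_mem/ST/mem_set ->.
  by [].
apply: ge0_integral_mono => x; first exact: lebesgue_vol_ge0.
by apply: IH => y /=; exact: ST.
Qed.

Definition vfloor k (x : 'cV[R]_k) : 'cV[int]_k := map_mx Num.floor x.

Lemma measure_floor_cell (N : nat) (j : int) : (0 < N)%N ->
  let C := [set x : R | Num.floor (N%:R * x) = j] in
  measurable C /\ lebesgue_measure C = (N%:R^-1)%:E.
Proof.
move=> N0 /=.
have NR : 0 < N%:R :> R by rewrite ltr0n.
have -> : [set x : R | Num.floor (N%:R * x) = j] =
    [set` `[(j%:~R / N%:R : R), ((j + 1)%:~R / N%:R : R)[].
  apply/seteqP; split=> x /=; rewrite in_itv /= ler_pdivrMr// ltr_pdivlMr//.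
    by move/eqP; rewrite floor_eq mulrC.
  by rewrite mulrC => h; apply/eqP; rewrite floor_eq.
split; first exact: measurable_itv.
rewrite lebesgue_measure_itv /= lte_fin ltr_pM2r ?invr_gt0//.
rewrite ltr_int ltrDl ltr01 -EFinB; congr (_%:E).
by rewrite intrD /=; field; lra.
Qed.

(** Induction on the dimension: the section of a union of cells at first
    coordinate [x] is the union of the cells whose index extends
    [floor (N x)], so its volume is a step function of [x]. *)
Lemma lebesgue_vol_cells k (N : nat) (F : seq 'cV[int]_k) :
  (0 < N)%N -> uniq F ->
  lebesgue_vol [set x : 'cV[R]_k | vfloor (N%:R *: x) \in F]
  = ((size F)%:R / N%:R ^+ k)%:E.
Proof.
move=> N0; elim: k F => [|k IH] F uF /=.
  rewrite expr0 divr1 indicE; congr (_%:R%:E).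
  have -> : (size F = (0%R \in F))%N.
    have F0 : {subset F <= [:: 0]} by move=> x _; rewrite (flatmx0 x) mem_head.
    have [F0in|nF0] := boolP (0 \in F).
      apply/eqP; rewrite eqn_leq (uniq_leq_size uF F0) /=.
      by case: F F0in {uF F0}.
    by case: F nF0 {uF F0} => // x F; rewrite (flatmx0 x) mem_head.
  congr nat_of_bool; apply/idP/idP => [/set_mem /=|h]; first by rewrite (flatmx0 (vfloor _)).
  by apply/mem_set; rewrite /= (flatmx0 (vfloor _)).
pose Fj (j : int) := [seq dsubmx (p : 'cV_(1 + k)) | p <- F & (p : 'cV_(1 + k)) (lshift k 0) 0 == j].
have uFj j : uniq (Fj j).
  rewrite map_inj_in_uniq ?filter_uniq// => p q.
  rewrite !mem_filter => /andP[/eqP pj _] /andP[/eqP qj _] pq.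
  rewrite -[p](@vsubmxK _ 1 k) -[q](@vsubmxK _ 1 k) pq; congr col_mx.
  by apply/matrixP=> a b; rewrite !mxE !ord1 pj qj.
have NR : 0 < N%:R :> R by rewrite ltr0n.
transitivity (\int[@lebesgue_measure R]_x
    \sum_(p <- F) ((N%:R ^- k)%:E *
      (\1_([set x : R | Num.floor (N%:R * x) = (p : 'cV_(1 + k)) (lshift k 0) 0]) x)%:E))%E.
  apply: eq_integral => x _.
  have -> : [set y : 'cV_k | vfloor (N%:R *: col_mx (x%:M : 'cV[R]_1) y) \in F] =
       [set y | vfloor (N%:R *: y) \in Fj (Num.floor (N%:R * x))].
    apply/seteqP; split=> y /=; rewrite scale_col_mx /vfloor map_col_mx.
      move=> yF; apply/mapP; eexists.
        rewrite mem_filter; apply/andP; split; last exact: yF.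
        by rewrite col_mxEu !mxE eqxx mulr1n.
      by rewrite col_mxKd.
    move=> /mapP[p]; rewrite mem_filter => /andP[/eqP p0 pF] ->.
    suff -> : map_mx Num.floor (N%:R *: (x%:M : 'cV[R]_1)) = usubmx (p : 'cV_(1 + k)).
      by rewrite vsubmxK.
    by apply/matrixP=> a b; rewrite !mxE !ord1 /= mulr1n p0.
  rewrite IH// size_map size_filter -sum1_count sumEFin natr_sum mulr_suml big_mkcond /=.
  congr (_%:E); apply: eq_bigr => p _.
  rewrite indicE; case: eqVneq => [->|h].
    by rewrite mem_set//= mulr1 mul1r.
  by rewrite memNset ?mulr0//= => e; move: h; rewrite e eqxx.
have mC (p : 'cV[int]_k.+1) := measure_floor_cell ((p : 'cV_(1 + k)) (lshift k 0) 0) N0.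
rewrite ge0_integral_sum//; last first.
  by move=> p; apply: measurable_funeM; apply/measurable_EFinP;
     apply: measurable_indic; exact: (mC p).1.
transitivity (\sum_(p <- F) (N%:R ^- k * N%:R^-1)%:E : \bar R)%E.
  apply: eq_bigr => p _.
  have [mCp vCp] := mC p.
  rewrite ge0_integralZl_EFin//; last first.
    by apply/measurable_EFinP; exact: measurable_indic.
  by rewrite integral_indic// setIT EFinM; congr (_ * _)%E; exact: vCp.
rewrite sumEFin big_const_seq count_predT iter_addr_0. congr (_%:E).
by rewrite -[LHS]mulr_natl exprSr invfM.
Qed.

End Volume.

(** * Convex hulls *)

Section ConvexHull.
Variables (R : realType) (V : lmodType R).
Implicit Types (S C : set V).

Lemma convex_hull_min S C :
  (forall x y (t : R), 0 <= t <= 1 -> C x -> C y -> C (t *: x + (1 - t) *: y)) ->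
  S `<=` C -> convex_hull S `<=` C.
Proof.
move=> cC; apply: smallest_sub => x y t /set_mem Cx /set_mem Cy.
apply/mem_set; apply: (cC _ _ t%:num) => //.
by apply/andP; split; [exact: ge0|exact: le1].
Qed.

Lemma convex_hull_convex S x y (t : R) : 0 <= t <= 1 ->
  convex_hull S x -> convex_hull S y -> convex_hull S (t *: x + (1 - t) *: y).
Proof.
move=> /andP[t0 t1] Sx Sy C [cC SC].
have Cx := Sx C (conj cC SC); have Cy := Sy C (conj cC SC).
by have /set_mem := cC _ _ (Itv01 t0 t1) (mem_set Cx) (mem_set Cy).
Qed.

(** Binary combinations suffice: along a list of points, the combination
    normalized by its total weight stays in the hull. *)
Lemma convex_hull_sum S (I : finType) (t : I -> R) (x : I -> V) :
  (forall i, 0 <= t i) -> \sum_i t i = 1 -> (forall i, convex_hull S (x i)) ->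
  convex_hull S (\sum_i t i *: x i).
Proof.
move=> t0 t1 xS.
have main (r : seq I) : let s := \sum_(i <- r) t i in
    s != 0 -> convex_hull S (s^-1 *: \sum_(i <- r) t i *: x i).
  elim: r => [|i r IH] /=; first by rewrite big_nil eqxx.
  rewrite !big_cons; set s := \sum_(j <- r) t j in IH *; set z := \sum_(j <- r) _ in IH *.
  have s0 : 0 <= s by apply: sumr_ge0 => j _.
  have ti := t0 i.
  have [sE|sn0] := eqVneq s 0.
    have -> : z = 0.
      rewrite /z big1_seq// => j /= jr; move: sE => /eqP.
      rewrite psumr_eq0 // => /allP/(_ _ jr)/= /eqP ->; exact: scale0r.
    rewrite sE !addr0 => tn0; rewrite scalerA mulVf// scale1r; exact: xS.
  move=> tsn0.
  have ts : 0 < t i + s by rewrite lt_neqAle eq_sym tsn0 addr_ge0.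
  have -> : (t i + s)^-1 *: (t i *: x i + z) =
     (t i / (t i + s)) *: x i + (1 - t i / (t i + s)) *: (s^-1 *: z).
    rewrite scalerDr !scalerA; congr (_ *: _ + _ *: _); first by rewrite mulrC.
    by field; rewrite sn0 tsn0.
  apply: convex_hull_convex; [|exact: xS|exact: IH].
  by rewrite divr_ge0 ?(ltW ts)//= ler_pdivrMr// mul1r lerDl.
have := main (index_enum I); rewrite /= t1 invr1 scale1r; apply.
exact: oner_neq0.
Qed.

End ConvexHull.

(** * Lattice points of dilated simplices *)

Lemma lattice_points_simplex k m : exists L : seq 'cV[int]_k,
  [/\ uniq L, size L = 'C(k + m, k) &
      forall q, (q \in L) = [forall i, 0 <= q i 0] && (\sum_i q i 0 <= m%:Z)].
Proof.
pose f (t : k.-tuple 'I_m.+1) : 'cV[int]_k := \col_i (tnth t i : nat)%:Z.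
have f_inj : injective f.
  move=> s t /matrixP st; apply: eq_from_tnth => i.
  by have := st i 0; rewrite !mxE => -[] /val_inj.
exists [seq f t | t <- enum [set t : k.-tuple 'I_m.+1 | (\sum_(i <- t) i <= m)%N]%SET].
split.
- by rewrite map_inj_uniq ?enum_uniq.
- by rewrite size_map -cardE card_partial_ord_partitions.
have sumf t : \sum_i f t i 0 = (\sum_(i <- t) i)%N%:Z.
  rewrite big_tuple (big_morph Posz PoszD (erefl _)).
  by apply: eq_bigr => i _; rewrite mxE.
move=> q; apply/mapP/andP => [[t]|[/forallP q0 qm]].
  rewrite mem_enum inE => tm ->; split; last by rewrite sumf lez_nat.
  by apply/forallP => i; rewrite mxE.
have qi i : (absz (q i 0%R) < m.+1)%N.
  rewrite ltnS -lez_nat gez0_abs// (le_trans _ qm)// (bigD1 i)//=.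
  by rewrite lerDl sumr_ge0.
have qE : q = f [tuple Ordinal (qi i) | i < k].
  by apply/matrixP => i j; rewrite !mxE tnth_mktuple /= ord1 gez0_abs.
exists [tuple Ordinal (qi i) | i < k]; last exact: qE.
by rewrite mem_enum inE -lez_nat -sumf -qE.
Qed.

Section Limits.
Variable R : realType.

Lemma cvg_1D_div_exp (k : nat) (c : R) :
  (fun N : nat => (1 + c / N.+1%:R) ^+ k) @ \oo --> (1 : R).
Proof.
have h : (fun N : nat => 1 + c / N.+1%:R) @ \oo --> (1 : R).
  rewrite -[X in _ --> X]addr0 -(mulr0 c).
  apply: cvgD; first exact: cvg_cst.
  apply: cvgM; first exact: cvg_cst.
  exact: cvg_harmonic.
rewrite -[X in _ --> X](expr1n R k).
exact: (cvg_comp _ _ h (@exprn_continuous R k 1)).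
Qed.

(** [k`! * 'C(k + m, k)] is the falling factorial [(m + 1) ... (m + k)], which
    lies between [m ^ k] and [(m + k) ^ k]. *)
Lemma cvg_binomial_ratio (k a b : nat) :
  (fun N : nat => k`!%:R * ('C(k + (N.+1 + a - b), k)%:R / N.+1%:R ^+ k)) @ \oo --> (1 : R).
Proof.
apply: (@squeeze_cvgr _ _ _ _ (fun N : nat => (1 + - b%:R / N.+1%:R) ^+ k)
   (fun N : nat => (1 + (a + k)%:R / N.+1%:R) ^+ k)); [|exact: cvg_1D_div_exp..].
exists b => // N /= bN.
have N0 : 0 < N.+1%:R :> R by rewrite ltr0n.
have E : k`!%:R * ('C(k + (N.+1 + a - b), k)%:R / N.+1%:R ^+ k) =
   ((k + (N.+1 + a - b)) ^_ k)%:R / N.+1%:R ^+ k :> R.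
  by rewrite mulrA -natrM mulnC bin_ffact.
have ED (c : R) : (1 + c / N.+1%:R) ^+ k = (N.+1%:R + c) ^+ k / N.+1%:R ^+ k.
  by rewrite -expr_div_n; congr (_ ^+ _); field; lra.
rewrite E !ED !ler_pM2r ?invr_gt0 ?exprn_gt0//.
have EB : N.+1%:R - b%:R = (N.+1 - b)%:R :> R by rewrite natrB// ltnW.
rewrite EB -natrD -!natrX !ler_nat ffact_prod -(card_ord k) -!prod_nat_const.
by rewrite !card_ord; apply/andP; split; apply: leq_prod => i _; have := ltn_ord i; lia.
Qed.

End Limits.

(** * Volume of a unimodular simplex *)

Lemma mulmx_sum_col (K : comPzRingType) m n (M : 'M[K]_(m, n)) (v : 'cV[K]_n) :
  M *m v = \sum_j v j 0 *: col j M.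
Proof.
apply/matrixP=> i j; rewrite summxE ord1 mxE; apply: eq_bigr => l _.
by rewrite !mxE mulrC.
Qed.

Lemma cst_cvg_eq (R : realType) (x y : R) : (fun _ : nat => x) @ \oo --> y -> x = y.
Proof.
by move=> xy; rewrite -(cvg_lim (@norm_hausdorff _ _) xy) lim_cst.
Qed.

Section Simplex.
Variables (R : realType) (k : nat) (U V : 'M[int]_k).
Hypothesis UV : U *m V = 1%:M.

Let VU : V *m U = 1%:M. Proof. exact: mulmx1C. Qed.

Let coord (x : 'cV[R]_k) : 'cV[R]_k := intmxR R V *m x.

Let coordK (x : 'cV[R]_k) : intmxR R U *m coord x = x.
Proof. by rewrite /coord mulmxA /intmxR -map_mxM UV map_mx1 mul1mx. Qed.

Let coord_col i : coord (intmxR R (col i U)) = delta_mx i 0.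
Proof.
by rewrite /coord /intmxR map_col colE mulmxA -map_mxM VU map_mx1 mul1mx.
Qed.

Let coord0 : coord (intmxR R 0) = 0.
Proof. by rewrite /coord /intmxR map_mx0 mulmx0. Qed.

Let sum_delta i : \sum_(j < k) (delta_mx i 0 : 'cV[R]_k) j 0 = 1.
Proof.
rewrite (bigD1 i)//= mxE !eqxx big1 ?addr0// => j ji.
by rewrite mxE (negbTE ji).
Qed.

Let coord_conv (x y : 'cV[R]_k) (t : R) i :
  coord (t *: x + (1 - t) *: y) i 0 = t * coord x i 0 + (1 - t) * coord y i 0.
Proof. by rewrite /coord mulmxDr -!scalemxAr !mxE. Qed.

Let vertices := [set col i U | i in [set: 'I_k]].

Lemma convex_hull_simplexP (x : 'cV[R]_k) :
  convex_hull (intmxR R @` ([set 0] `|` vertices)) x <->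
  (forall i, 0 <= coord x i 0) /\ \sum_i coord x i 0 <= 1.
Proof.
split.
  move: x; apply: convex_hull_min => [x y t /andP[t0 t1] [x0 x1] [y0 y1]|].
    split=> [i|]; first by rewrite coord_conv addr_ge0// mulr_ge0// subr_ge0.
    under eq_bigr do rewrite coord_conv.
    rewrite big_split /= -!mulr_sumr; nra.
  move=> _ [_ [->|[i _ <-] ] <-].
    by rewrite coord0; split=> [i|]; rewrite ?mxE// big1// => i _; rewrite mxE.
  by rewrite coord_col sum_delta; split=> // j; rewrite mxE.
move=> [x0 x1].
(* The index [ord0] stands for the vertex [0], the others for the columns. *)
pose t (o : 'I_k.+1) := oapp (fun i => coord x i 0) (1 - \sum_i coord x i 0) (unlift ord0 o).
pose v (o : 'I_k.+1) := oapp (fun i => intmxR R (col i U)) 0 (unlift ord0 o).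
have -> : x = \sum_o t o *: v o.
  rewrite big_ord_recl /v unlift_none scaler0 add0r -[LHS]coordK mulmx_sum_col.
  by apply: eq_bigr => i _; rewrite /t liftK /= /intmxR map_col.
apply: convex_hull_sum => [o||o].
- by rewrite /t; case: (unlift _ _) => [i|] /=; rewrite ?x0// subr_ge0.
- rewrite big_ord_recl /t unlift_none /=.
  rewrite -[RHS](subrK (\sum_i coord x i 0)); congr (_ + _).
  by apply: eq_bigr => i _; rewrite liftK.
- rewrite /v; apply: sub_gen_smallest; case: (unlift _ _) => [i|] /=.
    by exists (col i U) => //; right; exists i.
  by exists 0; [left|rewrite /intmxR map_mx0].
Qed.

Lemma convex_hull_facet (x : 'cV[R]_k) :
  convex_hull (intmxR R @` vertices) x ->
  (forall i, 0 <= coord x i 0) /\ \sum_i coord x i 0 = 1.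
Proof.
move: x; apply: convex_hull_min => [x y t /andP[t0 t1] [x0 x1] [y0 y1]|].
  split=> [i|]; first by rewrite coord_conv addr_ge0// mulr_ge0// subr_ge0.
  under eq_bigr do rewrite coord_conv.
  by rewrite big_split /= -!mulr_sumr x1 y1; ring.
move=> _ [_ [i _ <-] <-].
by rewrite coord_col sum_delta; split=> // j; rewrite mxE.
Qed.

(** Replacing [N x] by its integer part changes each coordinate with respect
    to the columns of [U] by at most the sum of the absolute values of the
    entries of [V]. *)
Lemma coord_cell_bounded : exists C : nat, forall (N : nat) x i,
  `| N%:R * coord x i 0 - ((V *m vfloor (N%:R *: x)) i 0)%:~R | <= C%:R.
Proof.
exists (\sum_i \sum_j absz (V i j))%N => N x i.
have -> : N%:R * coord x i 0 - ((V *m vfloor (N%:R *: x)) i 0)%:~R =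
   \sum_j (V i j)%:~R * (N%:R * x j 0 - (Num.floor (N%:R * x j 0))%:~R) :> R.
  rewrite /coord !mxE rmorph_sum mulr_sumr -sumrB; apply: eq_bigr => j _.
  by rewrite !mxE rmorphM /=; ring.
apply: le_trans (ler_norm_sum _ _ _) _.
rewrite natr_sum [leRHS](bigD1 i)//= -[leLHS]addr0 lerD ?sumr_ge0// natr_sum.
apply: ler_sum => j _; rewrite normrM.
have -> : (absz (V i j))%:R = `|(V i j)%:~R| :> R.
  by rewrite natr_absz intr_norm.
apply: ler_piMr => //.
have := floor_itv (N%:R * x j 0); rewrite intrD /=.
move=> /andP[h1 h2]; rewrite ger0_norm; lra.
Qed.

Lemma coord_sum_cell_bounded (C N : nat) (x : 'cV[R]_k) :
  (forall i, `| N%:R * coord x i 0 - ((V *m vfloor (N%:R *: x)) i 0)%:~R | <= C%:R) ->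
  `| N%:R * (\sum_i coord x i 0) - (\sum_i (V *m vfloor (N%:R *: x)) i 0)%:~R |
    <= (k * C)%:R.
Proof.
move=> HC; rewrite mulr_sumr rmorph_sum -sumrB.
have -> : (k * C)%:R = \sum_(i < k) C%:R :> R.
  by rewrite sumr_const card_ord natrM mulr_natl.
by apply: le_trans (ler_norm_sum _ _ _) _; exact: ler_sum.
Qed.

(** The lattice points [p] with all coordinates at least [c] are the images
    under [U] of the nonnegative ones translated by [c], which preserves
    counts because [U] and the translation are bijections of [Z^k]. *)
Lemma lattice_points_unimodular_simplex (m : nat) (c : int) :
  exists F : seq 'cV[int]_k,
  [/\ uniq F, size F = 'C(k + m, k) &
      forall p, (p \in F) = [forall i, c <= (V *m p) i 0] &&
                            (\sum_i (V *m p) i 0 <= m%:Z + k%:Z * c)].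
Proof.
have [L [uL sL LP]] := lattice_points_simplex k m.
exists [seq U *m (q + const_mx c) | q <- L]; split; rewrite ?size_map//.
  rewrite map_inj_uniq// => p q /(congr1 (mulmx V)).
  by rewrite !mulmxA VU !mul1mx => /addIr.
move=> p.
have -> : (p \in [seq U *m (q + const_mx c) | q <- L]) = (V *m p - const_mx c \in L).
  apply/mapP/idP => [[q qL ->]|h].
    by rewrite mulmxA VU mul1mx addrK.
  by exists (V *m p - const_mx c) => //; rewrite subrK mulmxA UV mul1mx.
rewrite LP; congr andb.
  by apply: eq_forallb => i; rewrite !mxE subr_ge0.
rewrite (eq_bigr (fun i => (V *m p) i 0 - c)) => [|i _]; last first.
  by rewrite mxE [X in _ + X]mxE [X in - X]mxE.
by rewrite sumrB sumr_const card_ord lerBlDr -mulr_natl natz.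
Qed.

Let le_lebesgue_vol_cells (N : nat) (S : set 'cV[R]_k) (F : seq 'cV[int]_k) :
  uniq F -> (forall x, S x -> vfloor (N.+1%:R *: x) \in F) ->
  (lebesgue_vol S <= ((size F)%:R / N.+1%:R ^+ k)%:E)%E.
Proof.
by move=> uF SF; rewrite -lebesgue_vol_cells//; apply: le_lebesgue_vol.
Qed.

(** Cells with coordinates at least [C] and sum at most [N - k C] lie inside the
    simplex, while those meeting it have coordinates at least [- C] and sum at
    most [N + k C]. *)
Lemma simplex_volume_bounds : exists c : nat, forall N : nat, (c <= N)%N ->
  let S := convex_hull (intmxR R @` ([set 0] `|` vertices)) in
  (('C(k + (N.+1 + 0 - c), k)%:R / N.+1%:R ^+ k)%:E <= lebesgue_vol S)%E /\
  (lebesgue_vol S <= ('C(k + (N.+1 + c - 0), k)%:R / N.+1%:R ^+ k)%:E)%E.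
Proof.
have [C HC] := coord_cell_bounded.
exists (2 * (k * C))%N => N cN S.
have NR : 0 < N.+1%:R :> R by rewrite ltr0n.
have sumC (x : 'cV[R]_k) := coord_sum_cell_bounded (HC N.+1 x).
split.
  have [F [uF <- FP]] := lattice_points_unimodular_simplex (N.+1 + 0 - 2 * (k * C)) C.
  rewrite -lebesgue_vol_cells//; apply: le_lebesgue_vol => x /=.
  rewrite FP => /andP[/forallP Vp Vs]; apply/convex_hull_simplexP; split=> [i|].
    have := HC N.+1 x i; have := Vp i; rewrite -(ler_int R) => h1.
    rewrite ler_norml => /andP[h2 _].
    by rewrite -(pmulr_rge0 _ NR); move: h1 h2; rewrite -pmulrn; lra.
  rewrite -(ler_pM2l NR) mulr1.
  have := sumC x; rewrite /= ler_norml => /andP[_ h2].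
  move: Vs; rewrite -(ler_int R) addn0 intrD -subzn; last by lia.
  rewrite intrB intrM -!pmulrn => h1.
  by move: h1 h2; rewrite !natrM -natr1; lra.
have [F [uF <- FP]] := lattice_points_unimodular_simplex (N.+1 + 2 * (k * C) - 0) (- C%:Z).
apply: le_lebesgue_vol_cells => // x /convex_hull_simplexP[x0 x1].
rewrite FP; apply/andP; split.
  apply/forallP => i; rewrite -(ler_int R) intrN -pmulrn.
  have := HC N.+1 x i; rewrite ler_norml => /andP[_ h2].
  have := x0 i; rewrite -(pmulr_rge0 _ NR); lra.
have := sumC x; rewrite /= ler_norml => /andP[h1 _].
rewrite -(ler_int R) subn0 intrD intrM intrN -!pmulrn.
rewrite -(ler_pM2l NR) mulr1 in x1.
by move: h1 x1; rewrite natrD !natrM -natr1; lra.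
Qed.

(** The cells meeting the facet are among the outer cells of the simplex, but
    have coordinate sum at least [N - k C]; those with a smaller sum are
    discarded, and the two counts have the same leading term. *)
Lemma facet_volume_bounds : exists c : nat, forall N : nat,
  (lebesgue_vol (convex_hull (intmxR R @` vertices)) <= ('C(k + (N.+1 + c - 0), k)%:R / N.+1%:R ^+ k
     - 'C(k + (N.+1 + 0 - 1), k)%:R / N.+1%:R ^+ k)%:E)%E.
Proof.
have [C HC] := coord_cell_bounded.
exists (2 * (k * C))%N => N.
have NR : 0 < N.+1%:R :> R by rewrite ltr0n.
have sumC (x : 'cV[R]_k) := coord_sum_cell_bounded (HC N.+1 x).
have [F1 [uF1 sF1 FP1]] := lattice_points_unimodular_simplex (N.+1 + 0 - 1) (- C%:Z).
have [F [uF sF FP]] := lattice_points_unimodular_simplex (N.+1 + 2 * (k * C) - 0) (- C%:Z).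
have F1F : {subset F1 <= F}.
  move=> p; rewrite FP1 FP => /andP[-> /=] /le_trans; apply.
  by rewrite lerD2r lez_nat; lia.
pose F' := [seq p <- F | p \notin F1].
have sF' : (size F' = size F - size F1)%N.
  have : perm_eq [seq p <- F | p \in F1] F1.
    apply: uniq_perm; rewrite ?filter_uniq// => p; rewrite mem_filter.
    by apply/andP/idP => [[]//|h]; split=> //; exact: F1F.
  move=> /perm_size; rewrite size_filter => <-.
  by rewrite /F' size_filter -(count_predC (mem F1) F) addKn.
rewrite -mulrBl; have := sF'; rewrite sF sF1 => sF''.
rewrite -natrB; last by rewrite -sF -sF1; exact: uniq_leq_size.
rewrite -{}sF''; apply: le_lebesgue_vol_cells; first exact: filter_uniq.
move=> x /convex_hull_facet[x0 x1].
have := sumC x; rewrite /= ler_norml x1 mulr1 => /andP[h1 h2].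
rewrite mem_filter FP FP1; set a := [forall i, _].
have -> : a.
  apply/forallP => i; rewrite -(ler_int R) intrN -pmulrn.
  have := HC N.+1 x i; rewrite ler_norml => /andP[_ h3].
  have := x0 i; rewrite -(pmulr_rge0 _ NR); lra.
rewrite /= -ltNge -(ltr_int R) -(ler_int R) subn0 addn0 subn1 /=.
rewrite !intrD !intrM !intrN -!pmulrn.
by move: h1 h2; rewrite natrD !natrM -natr1 => *; apply/andP; split; lra.
Qed.

Lemma normalized_vol_unimodular_simplex :
  normalized_vol R ([set 0] `|` vertices) = 1%:E.
Proof.
rewrite /normalized_vol; set S := convex_hull _.
have [c cP] := simplex_volume_bounds.
have Sfin : lebesgue_vol S \is a fin_num.
  rewrite ge0_fin_numE ?lebesgue_vol_ge0//.
  by apply: le_lt_trans (cP c (leqnn c)).2 _; exact: ltry.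
rewrite -(fineK Sfin) -EFinM; congr (_%:E); set v := fine _.
apply: cst_cvg_eq.
apply: (squeeze_cvgr (f := fun N => k`!%:R * ('C(k + (N.+1 + 0 - c), k)%:R / N.+1%:R ^+ k))
  (h := fun N => k`!%:R * ('C(k + (N.+1 + c - 0), k)%:R / N.+1%:R ^+ k)));
  [|exact: cvg_binomial_ratio..].
exists c => // N /= /cP [h1 h2].
by rewrite !ler_pM2l ?ltr0n ?fact_gt0// -!lee_fin fineK//; apply/andP.
Qed.

Lemma normalized_vol_unimodular_facet : normalized_vol R vertices = 0%:E.
Proof.
rewrite /normalized_vol; set S := convex_hull _.
have [c cP] := facet_volume_bounds.
have Sfin : lebesgue_vol S \is a fin_num.
  rewrite ge0_fin_numE ?lebesgue_vol_ge0//.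
  by apply: le_lt_trans (cP c) _; exact: ltry.
rewrite -(fineK Sfin) -EFinM; congr (_%:E); set v := fine _.
apply: cst_cvg_eq.
have h0 := cvgB (@cvg_binomial_ratio R k c 0) (@cvg_binomial_ratio R k 0 1).
rewrite subrr in h0; apply: (squeeze_cvgr (f := fun=> 0)
  (h := fun N => k`!%:R * ('C(k + (N.+1 + c - 0), k)%:R / N.+1%:R ^+ k)
     - k`!%:R * ('C(k + (N.+1 + 0 - 1), k)%:R / N.+1%:R ^+ k)));
  [|exact: cvg_cst|exact: h0].
apply: nearW => N /=; rewrite mulr_ge0 ?fine_ge0 ?lebesgue_vol_ge0//=.
by rewrite -mulrBr ler_pM2l ?ltr0n ?fact_gt0// -lee_fin fineK.
Qed.

End Simplex.

(** * Column combinations and faces *)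

Definition supported (K : zmodType) (n : nat) (I : set 'I_n) (v : 'cV[K]_n) : Prop :=
  forall i, ~ I i -> v i 0 = 0.

Lemma supportedB (K : zmodType) n (I : set 'I_n) (v w : 'cV[K]_n) :
  supported I v -> supported I w -> supported I (v - w).
Proof. by move=> Iv Iw i Ii; rewrite !mxE Iv// Iw// subrr. Qed.

Lemma supportedW (K : zmodType) n (I J : set 'I_n) (v : 'cV[K]_n) :
  I `<=` J -> supported I v -> supported J v.
Proof. by move=> IJ Iv i Ji; apply: Iv => /IJ. Qed.

Lemma supported_delta (K : pzRingType) n (I : set 'I_n) (i : 'I_n) :
  I i -> supported I (delta_mx i 0 : 'cV[K]_n).
Proof.
by move=> Ii j Ij; rewrite mxE; case: eqP => // ji; case: Ij; rewrite ji.
Qed.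

Section Faces.
Variables (R : realType) (d n : nat) (A : 'M[int]_(d, n)).
Implicit Types alpha beta : set 'cV[R]_d.
Let AR := intmxR R A.

Lemma face_latticeP alpha (x : 'cV[int]_d) :
  face_lattice A alpha x <->
  exists2 m : 'cV[int]_n, supported (lies_on A alpha) m & x = A *m m.
Proof.
split.
  pose H := [set y | exists2 m : 'cV[int]_n, supported (lies_on A alpha) m & y = A *m m].
  apply: (@smallest_sub _ _ _ H) => [|_ [i Ai <-]]; last first.
    by exists (delta_mx i 0); [exact: supported_delta|rewrite -colE].
  split; first by apply/mem_set; exists 0; [move=> i _; rewrite mxE|rewrite mulmx0].
  move=> _ _ /set_mem[v Iv ->] /set_mem[w Iw ->]; apply/mem_set.
  by exists (v - w); [exact: supportedB|rewrite mulmxBr].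
move=> [m Im ->] H [[H0 HB] AH].
have HN y : H y -> H (- y).
  by move=> Hy; rewrite -sub0r; apply/set_mem/HB; [exact: H0|exact/mem_set].
have HD y z : H y -> H z -> H (y + z).
  move=> Hy Hz; rewrite -[z]opprK; apply/set_mem/HB; apply/mem_set => //.
  exact: HN.
have Hn y (p : nat) : H y -> H (y *+ p).
  by move=> Hy; elim: p => [|p IH]; [exact/set_mem|rewrite mulrS; exact: HD].
rewrite mulmx_sum_col; apply: (big_ind H) => [|//|i _]; first exact/set_mem.
have [Ai|nAi] := pselect (lies_on A alpha i); last by rewrite Im// scale0r; exact/set_mem.
have Hi : H (col i A) by apply: AH; exists i.
case: (m i 0) => p; rewrite ?NegzE ?scaleNr -?natz scaler_nat; first exact: Hn.
by apply: HN; exact: Hn.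
Qed.

Lemma mem_face_lattice alpha i : lies_on A alpha i -> face_lattice A alpha (col i A).
Proof.
by move=> Ai; apply: sub_gen_smallest; exists i.
Qed.

Lemma ConvP (x : 'cV[R]_d) : Conv R A x ->
  exists t : 'cV[R]_n, [/\ forall i, 0 <= t i 0, \sum_i t i 0 = 1 & x = AR *m t].
Proof.
move: x; apply: convex_hull_min => [_ _ s /andP[s0 s1] [t [t0 t1 ->]] [u [u0 u1 ->]]|].
  exists (s *: t + (1 - s) *: u); split.
  - by move=> i; rewrite !mxE addr_ge0// mulr_ge0// subr_ge0.
  - under eq_bigr do rewrite !mxE.
    by rewrite big_split /= -!mulr_sumr t1 u1; ring.
  - by rewrite mulmxDr -!scalemxAr.
move=> _ [i _ <-]; exists (delta_mx i 0); split.
- by move=> j; rewrite mxE.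
- rewrite (bigD1 i)//= mxE !eqxx big1 ?addr0// => j ji.
  by rewrite mxE (negbTE ji).
- by rewrite -colE /AR /intmxR map_col.
Qed.

Lemma Conv_col i : Conv R A (intmxR R (col i A)).
Proof. by apply: sub_gen_smallest; exists i. Qed.

(** At a point of a convex combination where the supporting functional attains
    its maximum, every column with a positive weight attains it too. *)
Lemma face_combination alpha (x : 'cV[R]_d) : face (Conv R A) alpha -> alpha x ->
  exists2 t : 'cV[R]_n, supported (lies_on A alpha) t &
     \sum_i t i 0 = 1 /\ x = AR *m t.
Proof.
move=> [_ [u [c [uc ->]]]] [/ConvP[t [t0 t1 xE]] ux].
exists t => // i; rewrite /lies_on /= => ni.
have cu j : 0 <= c - (u *m AR) 0 j.
  rewrite subr_ge0; have := uc _ (Conv_col j).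
  by rewrite /intmxR map_col colE mulmxA -colE mxE.
have : \sum_j t j 0 * (c - (u *m AR) 0 j) = 0.
  under eq_bigr do rewrite mulrBr.
  rewrite sumrB -mulr_suml t1 mul1r -ux xE mulmxA [X in X - _]mxE.
  by apply/eqP; rewrite subr_eq0; apply/eqP/eq_bigr => j _; rewrite mulrC.
move=> /eqP; rewrite psumr_eq0 => [/allP/(_ i)|j _]; last by rewrite mulr_ge0.
rewrite mem_index_enum mulf_eq0 => /(_ isT) /orP[/eqP//|/=].
rewrite subr_eq0 => /eqP cE; case: ni; split; first exact: Conv_col.
by rewrite /intmxR map_col colE mulmxA -colE mxE -cE.
Qed.

Lemma face_sub_linear_span alpha (x : 'cV[R]_d) : face (Conv R A) alpha ->
  linear_span alpha x -> exists2 t : 'cV[R]_n, supported (lies_on A alpha) t & x = AR *m t.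
Proof.
move=> fa.
pose H := [set y | exists2 t : 'cV[R]_n, supported (lies_on A alpha) t & y = AR *m t].
apply: (@smallest_sub _ _ _ H) => [|y ay]; last first.
  by have [t It [_ yE]] := face_combination fa ay; exists t.
split; first by apply/mem_set; exists 0; [move=> i _; rewrite mxE|rewrite mulmx0].
move=> a _ _ /set_mem[v Iv ->] /set_mem[w Iw ->]; apply/mem_set.
exists (a *: v + w); last by rewrite mulmxDr -scalemxAr.
by move=> i Ii; rewrite !mxE Iv// Iw// mulr0 addr0.
Qed.

Lemma face_has_column alpha : face (Conv R A) alpha -> exists i, lies_on A alpha i.
Proof.
move=> fa; have [[x ax] _] := fa.
have [t It [t1 _]] := face_combination fa ax.
apply/not_existsP => h; move: t1; rewrite big1 => [/eqP|i _]; last exact: It.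
by rewrite eq_sym oner_eq0.
Qed.

Section Rank.
Variable l : 'rV[R]_d.
Hypothesis lA : l *m AR = const_mx 1.

(** Off the face the rows are zeroed rather than deleted, so that the matrices
    of two faces have the same shape. *)
Definition face_rows alpha : 'M[R]_(n, d) :=
  \matrix_i (if `[< lies_on A alpha i >] then (col i AR)^T else 0).

(** The functional [l] takes the value [1] on every column, so the columns lie
    on an affine hyperplane avoiding [0], on which affine independence is
    linear independence. *)
Lemma affine_dim_face alpha : face (Conv R A) alpha ->
  (affine_dim alpha).+1 = \rank (face_rows alpha).
Proof.
move=> fa; apply/eqP; rewrite eqn_leq; apply/andP; split.
  have [i Ai] := face_has_column fa.
  have r0 : (0 < \rank (face_rows alpha))%N.
    rewrite lt0n mxrank_eq0; apply/eqP => /(congr1 (row i)).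
    rewrite rowK asboolT// row0 => /(congr1 (mulmx l \o trmx)) /=.
    rewrite trmxK trmx0 mulmx0 colE mulmxA lA => /matrixP/(_ 0 0).
    by rewrite -colE !mxE => /eqP; rewrite oner_eq0.
  rewrite -(prednK r0) ltnS; apply/bigmax_leqP => m /asboolP[x [ax xfree]].
  rewrite -ltnS (prednK r0).
  pose X : 'M[R]_(m.+1, d) := \matrix_j (x j)^T.
  have Xfree : row_free X.
    apply: inj_row_free => v vX.
    have vx : \sum_i v 0 i *: x i = 0.
      apply: trmx_inj; rewrite trmx0 -vX mulmx_sum_row linear_sum /=.
      by apply: eq_bigr => i' _; rewrite linearZ /= rowK.
    suff v0 : forall i, v 0 i = 0.
      by apply/matrixP => a b; rewrite ord1 v0 mxE.
    apply: xfree => //.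
    have := congr1 (mulmx l) vx; rewrite mulmx0 mulmx_sumr.
    move=> /matrixP/(_ 0 0); rewrite summxE [in RHS]mxE => lx; rewrite -[RHS]lx.
    apply: eq_bigr => i' _; rewrite -scalemxAr mxE.
    have [t _ [t1 ->]] := face_combination fa (ax i').
    rewrite mulmxA lA mxE -[LHS]mulr1 -[X in _ * X = _]t1; congr (_ * _).
    by apply: eq_bigr => q _; rewrite mxE mul1r.
  rewrite -(eqP Xfree); apply: mxrankS; apply/row_subP => j; rewrite rowK.
  have [t It [_ ->]] := face_combination fa (ax j).
  rewrite trmx_mul; apply/submxP; exists t^T; apply/matrixP => a b; rewrite [a]ord1.
  rewrite !mxE; apply: eq_bigr => q _; rewrite !mxE.
  by case: asboolP => [_|/It ->]; rewrite !mxE ?mul0r ?mulr0.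
have main r (f : 'I_r -> 'I_n) : row_free (rowsub f (face_rows alpha)) ->
    (r <= (affine_dim alpha).+1)%N.
  case: r f => // m f ffree; rewrite ltnS.
  have md : (m < d.+1)%N.
    by rewrite ltnW// ltnS -(eqP ffree) rank_leq_col.
  apply: (bigop.bigmax_sup (Ordinal md)) => //=; apply/asboolP.
  have Lf j : lies_on A alpha (f j).
    apply: contrapT => nL; have := row_free_inj ffree.
    move=> /(_ 1%N) /(_ (delta_mx 0 j) 0) /=; rewrite mul0mx -rowE row_rowsub rowK asboolF//.
    move=> /(_ erefl)/matrixP/(_ 0 j); rewrite !mxE !eqxx => /eqP.
    by rewrite oner_eq0.
  exists (fun j => intmxR R (col (f j) A)); split=> [j|c _ cx j]; first exact: Lf.
  have := row_free_inj ffree => /(_ 1%N) /(_ (\row_j c j) 0) /=.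
  rewrite mul0mx => h; suff /h/matrixP/(_ 0 j) : 
    \row_j c j *m rowsub f (face_rows alpha) = 0 by rewrite !mxE.
  rewrite mulmx_sum_row; apply: trmx_inj; rewrite trmx0 -[RHS]cx linear_sum /=.
  apply: eq_bigr => i _; rewrite linearZ /= row_rowsub rowK asboolT// trmxK mxE.
  by rewrite /AR /intmxR map_col.
exact: main (maxrowsub_free _).
Qed.

End Rank.
End Faces.

(** * The quotient lattice of a pair of faces *)

Section Selection.
Variables (n : nat) (D : {set 'I_n}).

(** Extends by zero a vector indexed by [D] to one indexed by ['I_n]. *)
Definition selection_mx (K : pzRingType) : 'M[K]_(n, #|D|) :=
  \matrix_(i, j) (i == enum_val j)%:R.

Lemma selection_mx_mul (K : pzRingType) (w : 'cV[K]_#|D|) j :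
  (selection_mx K *m w) (enum_val j) 0 = w j 0.
Proof.
rewrite mxE (bigD1 j)//= mxE eqxx mul1r big1 ?addr0// => i ij.
rewrite mxE; case: eqP => [/enum_val_inj ji|_]; last by rewrite mul0r.
by rewrite ji eqxx in ij.
Qed.

Lemma selection_mx_supported (K : pzRingType) (w : 'cV[K]_#|D|) :
  supported [set i | i \in D] (selection_mx K *m w).
Proof.
move=> i iD; rewrite mxE big1// => j _; rewrite mxE.
case: eqP => [ij|_]; last by rewrite mul0r.
by case: iD; rewrite /= ij enum_valP.
Qed.

Lemma col_mul_selection (K : pzRingType) m (M : 'M[K]_(m, n)) j :
  col j (M *m selection_mx K) = col (enum_val j) M.
Proof.
apply/matrixP => a b; rewrite !mxE (bigD1 (enum_val j))//= mxE eqxx mulr1.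
by rewrite big1 ?addr0// => i ij; rewrite mxE (negbTE ij) mulr0.
Qed.

End Selection.

Section RelativeFace.
Variables (R : realType) (d n : nat) (A : 'M[int]_(d, n)).
Variables alpha beta : set 'cV[R]_d.
Let AR := intmxR R A.
Let Ia := lies_on A alpha.
Let Ib := lies_on A beta.

Hypothesis fa : face (Conv R A) alpha.
Hypothesis fb : face (Conv R A) beta.
Hypothesis ba : beta `<=` alpha.
Hypothesis relations_on_beta : forall v : 'cV[R]_n,
  AR *m v = 0 -> supported Ia v -> supported Ib v.

Let Iba : Ib `<=` Ia. Proof. by move=> i; exact: ba. Qed.

Definition columns_off : {set 'I_n} :=
  [set i | `[< lies_on A alpha i >] && ~~ `[< lies_on A beta i >]]%SET.

Let k := #|columns_off|.

Let off_a (j : 'I_k) : Ia (enum_val j).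
Proof. by have := enum_valP j; rewrite inE => /andP[/asboolP]. Qed.

Let off_b (j : 'I_k) : ~ Ib (enum_val j).
Proof. by have := enum_valP j; rewrite inE => /andP[_ /asboolPn]. Qed.

Let sel_a (K : pzRingType) (w : 'cV[K]_k) : supported Ia (selection_mx columns_off K *m w).
Proof.
apply: supportedW (selection_mx_supported w) => i /=.
by rewrite inE => /andP[/asboolP].
Qed.

Let coef (K : pzRingType) (m : 'cV[K]_n) : 'cV[K]_k := \col_j m (enum_val j) 0.

Let coefB (K : pzRingType) (v w : 'cV[K]_n) : coef (v - w) = coef v - coef w.
Proof. by apply/matrixP => i j; rewrite !mxE. Qed.

Let coef_sel (K : pzRingType) (w : 'cV[K]_k) : coef (selection_mx columns_off K *m w) = w.
Proof.
by apply/matrixP => i j; rewrite mxE selection_mx_mul ord1.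
Qed.

Let coef_b (K : pzRingType) (v : 'cV[K]_n) : supported Ib v -> coef v = 0.
Proof. by move=> vb; apply/matrixP => i j; rewrite !mxE vb//; exact: off_b. Qed.

Let supp_coef0 (K : pzRingType) (v : 'cV[K]_n) : supported Ia v -> coef v = 0 -> supported Ib v.
Proof.
move=> va v0 i nb; have [ai|nai] := pselect (Ia i); last exact: va.
have iD : i \in columns_off by rewrite inE asboolT//= asboolF.
have := congr1 (fun M : 'cV_k => M (enum_rank_in iD i) 0) v0.
by rewrite !mxE enum_rankK_in.
Qed.

(** This is what makes the coordinates along the columns off [beta] well defined
    on [Z alpha]. *)
Let coef_rel (v w : 'cV[int]_n) : supported Ia v -> supported Ia w ->
  A *m v = A *m w -> coef v = coef w.
Proof.
move=> va wa /eqP; rewrite -subr_eq0 -mulmxBr => /eqP Avw.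
apply/eqP; rewrite -subr_eq0 -coefB; apply/eqP.
have vw : supported Ib (intmxR R (v - w)).
  apply: relations_on_beta; first by rewrite /AR /intmxR -map_mxM Avw map_mx0.
  by move=> i Ii; rewrite mxE (supportedB va wa)//.
by apply: coef_b => i /vw; rewrite mxE => /eqP; rewrite intr_eq0 => /eqP.
Qed.

(** An element of [Z alpha] in the span of [beta] has an integer expression on
    [alpha] and a real one on [beta]; their difference is a relation on
    [alpha], hence on [beta], so the integer expression has no coefficient off
    [beta]. *)
Lemma face_lattice_in_spanE : face_lattice_in_span A alpha beta = face_lattice A beta.
Proof.
apply/seteqP; split=> x.
  move=> [/face_latticeP[m ma xE] /= /(face_sub_linear_span fb)[t tb xt]].
  have h : supported Ib (intmxR R m - t).
    apply: relations_on_beta.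
      by rewrite mulmxBr -xt /AR /intmxR -map_mxM -xE subrr.
    apply: supportedB; last exact: supportedW tb.
    by move=> i Ii; rewrite mxE ma//.
  apply/face_latticeP; exists m => // i nb.
  have := h _ nb; rewrite !mxE (tb i nb) subr0 => /eqP.
  by rewrite intr_eq0 => /eqP.
move=> /face_latticeP[m mb ->]; split.
  by apply/face_latticeP; exists m => //; exact: supportedW mb.
rewrite /= /intmxR map_mxM mulmx_sum_col => H [[H0 HD] bH].
apply: (big_ind (fun z => H z)) => [|y z Hy Hz|i _]; first exact/set_mem.
  by rewrite -[y]scale1r; apply/set_mem/HD; exact/mem_set.
have [bi|nbi] := pselect (Ib i).
  rewrite -[_ *: _]addr0; apply/set_mem/HD; last exact: H0.
  by apply/mem_set/bH; have := bi; rewrite /Ib /lies_on /intmxR map_col.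
have -> : map_mx intr m i 0 = 0 :> R by rewrite mxE mb.
rewrite scale0r;
exact/set_mem.
Qed.

Lemma face_index1 : face_index A alpha beta = 1%N.
Proof.
rewrite /face_index /subgroup_index face_lattice_in_spanE.
set H := face_lattice A beta.
have H0 : H 0 by apply/face_latticeP; exists 0; [move=> i _; rewrite mxE|rewrite mulmx0].
have -> : [set [set x + y | y in H] | x in H] = [set H].
  apply/seteqP; split=> [_ [x Hx <-]|_ ->]; last first.
    exists 0 => //; apply/seteqP; split=> [_ [y Hy <-]|y Hy]; rewrite ?add0r//.
    by exists y => //; rewrite add0r.
  move: Hx => /face_latticeP[v vb xE].
  apply/seteqP; split=> [_ [_ /face_latticeP[w wb ->] <-]|_ /face_latticeP[w wb ->]].
    apply/face_latticeP; exists (v + w); last by rewrite xE mulmxDr.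
    by move=> i Ii; rewrite mxE vb// wb// addr0.
  exists (A *m (w - v)); last by rewrite xE mulmxBr addrC subrK.
  by apply/face_latticeP; exists (w - v) => //; exact: supportedB.
by rewrite fset_set1 cardfs1.
Qed.

(** A chart reads off the coefficients at the columns of [alpha] off [beta]. *)
Let chart_exists : exists phi : 'cV[int]_d -> 'cV[int]_k,
  quotient_chart (face_lattice A alpha) (face_lattice_in_span A alpha beta) phi.
Proof.
pose lift x : 'cV[int]_n := xget 0 [set m | supported Ia m /\ x = A *m m].
have liftP x : face_lattice A alpha x -> supported Ia (lift x) /\ x = A *m lift x.
  move=> /face_latticeP[m ma xE]; rewrite /lift.
  by case: xgetP => [m' _ //|/(_ m)]; case.
exists (fun x => coef (lift x)); split.
- move=> x y /set_mem/liftP[xa xE] /set_mem/liftP[ya yE].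
  have xya : supported Ia (lift x + lift y).
    by move=> i Ii; rewrite mxE xa// ya// addr0.
  have -> : coef (lift x) + coef (lift y) = coef (lift x + lift y).
    by apply/matrixP => i j; rewrite !mxE.
  have xyE : x + y = A *m (lift x + lift y) by rewrite mulmxDr -xE -yE.
  have /liftP[sa sE] : face_lattice A alpha (x + y).
    by apply/face_latticeP; exists (lift x + lift y).
  by apply: coef_rel => //; rewrite -sE.
- apply/seteqP; split=> // w _.
  pose x := A *m (selection_mx columns_off int *m w).
  have xa : face_lattice A alpha x.
    by apply/face_latticeP; eexists; first exact: sel_a w.
  exists x => //; have [sa sE] := liftP _ xa.
  by rewrite -[RHS]coef_sel; apply: coef_rel => //; exact: sel_a.
- rewrite face_lattice_in_spanE; apply/seteqP; split=> x.
    move=> [/liftP[xa xE] /= x0]; apply/face_latticeP; exists (lift x) => //.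
    exact: supp_coef0.
  move=> /face_latticeP[m mb xE].
  have ma := supportedW Iba mb.
  have xa : face_lattice A alpha x by apply/face_latticeP; exists m.
  split=> //=; have [sa sE] := liftP _ xa.
  by rewrite -(coef_b mb); apply: coef_rel => //; rewrite -sE.
Qed.

(** The chart kills the columns on [beta], so the images of the [k] other columns
    generate [Z^k]; expressing the standard basis in them gives the inverse
    matrix. *)
Lemma chart_image (phi : 'cV[int]_d -> 'cV[int]_k) :
  quotient_chart (face_lattice A alpha) (face_lattice_in_span A alpha beta) phi ->
  exists U V : 'M[int]_k, U *m V = 1%:M /\
    phi @` columns_on A alpha = [set 0] `|` [set col i U | i in [set: 'I_k]].
Proof.
move=> [phiD phi_surj phi_ker].
pose U : 'M[int]_k := \matrix_(i, j) phi (col (enum_val j) A) i 0.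
have colU j : col j U = phi (col (enum_val j) A).
  by apply/matrixP => a b; rewrite !mxE ord1.
have phi_b i : Ib i -> phi (col i A) = 0.
  move=> bi; suff : face_lattice_in_span A alpha beta (col i A).
    by rewrite -phi_ker => -[].
  by rewrite face_lattice_in_spanE; exact: mem_face_lattice.
have phi_a i : Ia i -> phi (col i A) = 0 \/ exists j, phi (col i A) = col j U.
  move=> ai; have [bi|nbi] := pselect (Ib i); [left; exact: phi_b|right].
  have iD : i \in columns_off by rewrite inE asboolT//= asboolF.
  by exists (enum_rank_in iD i); rewrite colU enum_rankK_in.
have GB x y : face_lattice A alpha x -> face_lattice A alpha y ->
    face_lattice A alpha (x - y).
  move=> /face_latticeP[v va ->] /face_latticeP[w wa ->].
  by apply/face_latticeP; exists (v - w); [exact: supportedB|rewrite mulmxBr].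
have phiB x y : face_lattice A alpha x -> face_lattice A alpha y ->
    phi (x - y) = phi x - phi y.
  move=> xa ya; apply/eqP; rewrite -subr_eq0 opprB addrA; apply/eqP.
  rewrite -phiD; [by rewrite subrK subrr|apply/mem_set; exact: GB|exact/mem_set].
(* Being in the image of [U] is checked on generators of [Z alpha]. *)
pose H := [set x | face_lattice A alpha x /\ exists w, phi x = U *m w].
have GH : face_lattice A alpha `<=` H.
  apply: smallest_sub => [|_ [i ai <-]]; last first.
    split; first exact: mem_face_lattice.
    have [->|[j ->]] := phi_a _ ai; first by exists 0; rewrite mulmx0.
    by exists (delta_mx j 0); rewrite -colE.
  have G0 : face_lattice A alpha 0.
    by apply/face_latticeP; exists 0; [move=> i _; rewrite mxE|rewrite mulmx0].
  split; first apply/mem_set; first split=> //.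
    by exists 0; rewrite mulmx0 -[X in phi X](subrr 0) phiB// subrr.
  move=> x y /set_mem[xa [v vE]] /set_mem[ya [w wE]]; apply/mem_set.
  by split; [exact: GB|exists (v - w); rewrite phiB// vE wE mulmxBr].
have Wex (j : 'I_k) : exists w : 'cV[int]_k, delta_mx j 0 = U *m w.
  have : [set: 'cV[int]_k] (delta_mx j 0) by [].
  by rewrite -phi_surj => -[x /GH[_ [w xw]] <-]; exists w.
have [W WP] := choice Wex.
exists U, (\matrix_(i, j) W j i 0); split.
  apply/matrixP => i j; transitivity ((U *m W j) i 0).
    rewrite mxE [in RHS]mxE; apply: eq_bigr => l _; congr (_ * _).
    by rewrite mxE.
  by rewrite -WP !mxE andbT.
apply/seteqP; split.
  move=> _ [_ [i ai <-] <-].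
  by have [->|[j ->]] := phi_a _ ai; [left|right; exists j].
move=> _ [->|[j _ <-]].
  have [i bi] := face_has_column fb.
  by exists (col i A); [exists i => //; exact: Iba|exact: phi_b].
by exists (col (enum_val j) A); [exists (enum_val j) => //; exact: off_a|rewrite colU].
Qed.

(** By [affine_dim_face] the claim is about ranks: the row spaces of [beta] and
    of the remaining columns are in direct sum, and the latter columns are
    free. *)
Lemma affine_dim_diff (l : 'rV[R]_d) : l *m AR = const_mx 1 ->
  (affine_dim alpha - affine_dim beta)%N = k.
Proof.
move=> lA.
pose D := rowsub (@enum_val _ (mem columns_off)) AR^T.
have rel (u : 'rV[R]_n) (w : 'rV[R]_k) :
    u *m face_rows A beta = w *m D -> w = 0.
  move=> uw; pose t : 'cV[R]_n := \col_i (if `[< Ib i >] then u 0 i else 0).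
  have tb : supported Ib t by move=> i nb; rewrite mxE asboolF.
  have tE : AR *m t = (u *m face_rows A beta)^T.
    apply/matrixP => i j; rewrite !mxE [j]ord1; apply: eq_bigr => q _.
    by rewrite !mxE; case: asboolP => _; rewrite !mxE ?mulr0// mulrC.
  have wE : AR *m (selection_mx columns_off R *m w^T) = (w *m D)^T.
    rewrite mulmxA trmx_mul; congr (_ *m _); apply/matrixP => i j.
    have /matrixP/(_ i 0) := col_mul_selection AR j.
    by rewrite mxE => ->; rewrite !mxE.
  have h : supported Ib (t - selection_mx columns_off R *m w^T).
    apply: relations_on_beta; first by rewrite mulmxBr tE wE uw subrr.
    by apply: supportedB; [exact: supportedW tb|exact: sel_a].
  have := coef_b h; rewrite coefB coef_b// coef_sel sub0r => /eqP.
  by rewrite oppr_eq0 => /eqP w0; apply: trmx_inj; rewrite w0 trmx0.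
have rD : \rank (D) = k.
  by apply/eqP/inj_row_free => v vD; apply: (rel 0); rewrite mul0mx vD.
have ra : \rank (face_rows A alpha) = (\rank (face_rows A beta) + k)%N.
  rewrite -rD -mxrank_sum_cap.
  have -> : \rank (face_rows A beta :&: D)%MS = 0%N.
    apply/eqP; rewrite mxrank_eq0 -submx0; apply/row_subP => j.
    have : (row j (face_rows A beta :&: D)%MS <=
       (face_rows A beta :&: D)%MS)%MS by exact: row_sub.
    rewrite sub_capmx => /andP[/submxP[u uE] /submxP[w wE]].
    by rewrite wE (rel u w) ?mul0mx ?sub0mx// -uE -wE.
  rewrite addn0; apply/eqmx_rank/andP; split.
    apply/row_subP => i; rewrite rowK; case: asboolP => [ai|_]; last exact: sub0mx.
    have [bi|nbi] := pselect (Ib i).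
      apply: submx_trans (addsmxSl _ _).
      have -> : (col i AR)^T = row i (face_rows A beta) by rewrite rowK asboolT.
      exact: row_sub.
    apply: submx_trans (addsmxSr _ _).
    have iD : i \in columns_off by rewrite inE asboolT//= asboolF.
    have -> : (col i AR)^T = row (enum_rank_in iD i) D.
      by rewrite row_rowsub enum_rankK_in// tr_col.
    exact: row_sub.
  rewrite addsmx_sub; apply/andP; split; apply/row_subP => i.
    rewrite rowK; case: asboolP => [bi|_]; last exact: sub0mx.
    have -> : (col i AR)^T = row i (face_rows A alpha).
      by rewrite rowK asboolT//; exact: Iba.
    exact: row_sub.
  have -> : row i D = row (enum_val i) (face_rows A alpha).
    by rewrite row_rowsub rowK asboolT ?tr_col//; exact: off_a.
  exact: row_sub.
have := affine_dim_face lA fa; have := affine_dim_face lA fb; lia.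
Qed.

Lemma subdiagram_vol1 (l : 'rV[R]_d) : l *m AR = const_mx 1 ->
  subdiagram_vol A alpha beta = 1%:E.
Proof.
move=> lA; rewrite /subdiagram_vol /= (affine_dim_diff lA).
case: xgetP => [phi _ phiP|nophi]; last first.
  by have [phi /nophi] := chart_exists.
have [U [V [UV imE]]] := chart_image phiP.
rewrite imE (normalized_vol_unimodular_simplex R UV).
have -> : ([set 0] `|` [set col i U | i in [set: 'I_k]]) `\ 0 =
    [set col i U | i in [set: 'I_k]].
  apply/seteqP; split=> [_ [[->|[i _ <-]] n0]|_ [i _ <-]]; [by case: n0|by exists i|].
  split; first by right; exists i.
  move=> /= /(congr1 (mulmx V)); rewrite colE mulmxA (mulmx1C UV) mul1mx mulmx0.
  by move=> /matrixP/(_ i 0)/eqP; rewrite !mxE !eqxx oner_eq0.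
by rewrite (normalized_vol_unimodular_facet R UV) sube0.
Qed.

End RelativeFace.

(** * Plane vectors *)

Lemma mul_row2 (K : pzRingType) (b : 'rV[K]_2) (c : 'cV[K]_2) :
  (b *m c) 0 0 = b 0 0 * c 0 0 + b 0 1 * c 1 0.
Proof. by rewrite mxE big_ord_recl big_ord1 (_ : lift _ _ = 1)//; apply/val_inj. Qed.

Lemma eq_cV2 (K : pzRingType) (c e : 'cV[K]_2) : c 0 0 = e 0 0 -> c 1 0 = e 1 0 -> c = e.
Proof.
move=> c0 c1; apply/matrixP => i j; rewrite ord1.
case: i => -[|[|//]] p.
  by rewrite (_ : Ordinal p = 0)//; apply/val_inj.
by rewrite (_ : Ordinal p = 1)//; apply/val_inj.
Qed.

Lemma parallel_det (K : idomainType) (b b' : 'rV[K]_2) (c : 'cV[K]_2) :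
  c != 0 -> (b *m c) 0 0 = 0 -> (b' *m c) 0 0 = 0 ->
  b 0 0 * b' 0 1 = b 0 1 * b' 0 0.
Proof.
move=> cn0; rewrite !mul_row2 => h h'.
have h0 : c 0 0 * (b 0 0 * b' 0 1 - b 0 1 * b' 0 0) = 0.
  transitivity (b' 0 1 * (b 0 0 * c 0 0 + b 0 1 * c 1 0) -
     b 0 1 * (b' 0 0 * c 0 0 + b' 0 1 * c 1 0)); first by ring.
  by rewrite h h' !mulr0 subrr.
have h1 : c 1 0 * (b 0 0 * b' 0 1 - b 0 1 * b' 0 0) = 0.
  transitivity (b 0 0 * (b' 0 0 * c 0 0 + b' 0 1 * c 1 0) -
     b' 0 0 * (b 0 0 * c 0 0 + b 0 1 * c 1 0)); first by ring.
  by rewrite h h' !mulr0 subrr.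
apply/eqP; rewrite -subr_eq0; apply/negPn/negP => dn0.
move: h0 h1 => /eqP; rewrite mulf_eq0 (negbTE dn0) orbF => /eqP c0 /eqP.
rewrite mulf_eq0 (negbTE dn0) orbF => /eqP c1.
by move: cn0; rewrite (@eq_cV2 _ c 0) ?mxE ?eqxx.
Qed.

Lemma row2_neq0 (K : realFieldType) (b : 'rV[K]_2) : b != 0 ->
  0 < b 0 0 * b 0 0 + b 0 1 * b 0 1.
Proof.
move=> bn0; rewrite -!expr2 lt_neqAle addr_ge0 ?sqr_ge0// andbT eq_sym.
rewrite paddr_eq0 ?sqr_ge0// !sqrf_eq0; apply: contra bn0 => /andP[/eqP b0 /eqP b1].
by apply/eqP/trmx_inj/eq_cV2; rewrite !mxE.
Qed.

(** Two vectors of the plane orthogonal to a third nonzero one are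
    proportional, and the ratio is a quotient of scalar products; its sign is
    that of the numerator. *)
Lemma parallel_scale (K : realFieldType) (b b' : 'rV[K]_2) (c : 'cV[K]_2) :
  c != 0 -> b != 0 -> (b *m c) 0 0 = 0 -> (b' *m c) 0 0 = 0 ->
  b' = ((b 0 0 * b' 0 0 + b 0 1 * b' 0 1) / (b 0 0 * b 0 0 + b 0 1 * b 0 1)) *: b.
Proof.
move=> cn0 bn0 bc b'c; have D := parallel_det cn0 bc b'c.
have := row2_neq0 bn0; set N := _ + _ => /lt0r_neq0 N0.
apply: trmx_inj; apply: eq_cV2; rewrite !mxE; apply: (mulIf N0).
  rewrite mulrAC divfK// /N; transitivity (b 0 0 * b 0 0 * b' 0 0 + b 0 1 * (b 0 1 * b' 0 0)).
    by ring.
  by rewrite -D; ring.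
rewrite mulrAC divfK// /N; transitivity (b 0 1 * b 0 1 * b' 0 1 + b 0 0 * (b 0 0 * b' 0 1)).
  by ring.
by rewrite D; ring.
Qed.

(** * Gale duality *)

Lemma intmxR_inj (R : realType) m n : injective (@intmxR R m n).
Proof.
move=> M N /matrixP MN; apply/matrixP => i j; have := MN i j.
by rewrite !mxE; exact: intr_inj.
Qed.

Lemma map_ratr_intr (R : realType) m n (M : 'M[int]_(m, n)) :
  map_mx ratr (map_mx intr M : 'M[rat]_(m, n)) = intmxR R M.
Proof. by apply/matrixP => i j; rewrite !mxE ratr_int. Qed.

Section Gale.
Variables (R : realType) (n : nat).
Hypothesis n_ge2 : (2 <= n)%N.
Variables (A : 'M[int]_(n - 2, n)) (B : 'M[int]_(n, 2)).
Hypothesis rankA : \rank (map_mx intr A : 'M[rat]_(n - 2, n)) = (n - 2)%N.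
Hypothesis galeB : gale_dual A B.
Hypothesis rowsB : forall i : 'I_n, row i B != 0.
Let AR := intmxR R A.
Let BR := intmxR R B.

Let row_BR i : row i BR = intmxR R (row i B).
Proof. by rewrite /BR /intmxR map_row. Qed.

Lemma gale_row_neq0 i : row i BR != 0.
Proof.
apply: contra (rowsB i) => /eqP h; apply/eqP; apply: (@intmxR_inj R).
by rewrite -row_BR h /intmxR map_mx0.
Qed.

Let mulBR (c : 'cV[R]_2) i : (BR *m c) i 0 = (row i BR *m c) 0 0.
Proof. by rewrite -row_mul [RHS]mxE. Qed.

Lemma gale_mul0 : AR *m BR = 0.
Proof. by case: galeB => AB _; rewrite /AR /BR /intmxR -map_mxM AB map_mx0. Qed.

(** If [B c = 0] with [c] real and nonzero, all rows are parallel to a fixed one,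
    so the integer vector obtained by rotating that nonzero row is killed by
    [B], against the uniqueness of integer coordinates. *)
Lemma gale_injective (c : 'cV[R]_2) : BR *m c = 0 -> c = 0.
Proof.
move=> Bc; apply/eqP/negPn/negP => cn0.
have i : 'I_n by exists 0%N; lia.
have rc j : (row j BR *m c) 0 0 = 0 by rewrite -mulBR Bc mxE.
(* The row [i] of [B] rotated by a right angle. *)
pose e : 'cV[int]_2 := \col_j (if j == 0 then - B i 1 else B i 0).
have e0 : e 0 0 = - B i 1 by rewrite mxE.
have e1 : e 1 0 = B i 0 by rewrite mxE.
have Be : B *m e = 0.
  apply/matrixP => j q; rewrite ord1.
  transitivity ((row j B *m e) 0 0); first by rewrite -row_mul [RHS]mxE.
  rewrite mul_row2 e0 e1 !mxE; apply: (@intr_inj R).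
  have := parallel_det cn0 (rc i) (rc j); rewrite !mxE => D.
  by rewrite mulr0z intrD !intrM intrN; lra.
have [_ /(_ 0)] := galeB; rewrite mulmx0 => /(_ erefl)[c0 [_ uc]].
have c00 : c0 = 0 by apply: uc; rewrite mulmx0.
have : e = 0 by rewrite -c00; symmetry; apply: uc; rewrite Be.
move=> ee; move: e0 e1; rewrite ee !mxE => b1 b0.
case/negP: (rowsB i); apply/eqP/trmx_inj/eq_cV2; rewrite !mxE //.
by apply/eqP; rewrite -oppr_eq0 -b1.
Qed.

(** Both the kernel of [A] and the image of [B] have dimension [2]. *)
Lemma gale_kernel (v : 'cV[R]_n) : AR *m v = 0 -> exists c : 'cV[R]_2, v = BR *m c.
Proof.
move=> Av.
have rAR : \rank AR = (n - 2)%N by rewrite /AR -map_ratr_intr mxrank_map.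
have rB : \rank BR^T = 2.
  apply/eqP/inj_row_free => w wB; apply: trmx_inj; rewrite trmx0.
  by apply: gale_injective; apply: trmx_inj; rewrite trmx_mul trmxK trmx0.
have BK : (BR^T <= kermx AR^T)%MS.
  by apply/sub_kermxP; rewrite -trmx_mul gale_mul0 trmx0.
have : (kermx AR^T <= BR^T)%MS.
  rewrite -(geq_leqif (mxrank_leqif_sup BK)) mxrank_ker mxrank_tr rAR rB.
  by rewrite subKn.
move=> KB; have /submx_trans/(_ KB)/submxP[D vD] : (v^T <= kermx AR^T)%MS.
  by apply/sub_kermxP; rewrite -trmx_mul Av trmx0.
by exists D^T; apply: trmx_inj; rewrite vD trmx_mul !trmxK.
Qed.

Variable l : 'rV[R]_(n - 2).
Hypothesis lA : l *m AR = const_mx 1.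

(** If [u] attains its maximum [c] on [P] exactly along [alpha], then [c - u]
    evaluated at the columns lies in the row space of [A], which [B] kills. *)
Lemma proper_face_positive_relation alpha : proper_face (Conv R A) alpha ->
  (exists i, ~ lies_on A alpha i) /\
  exists lam : 'rV[R]_n, [/\ lam *m BR = 0,
    forall i, lies_on A alpha i -> lam 0 i = 0 &
    forall i, ~ lies_on A alpha i -> 0 < lam 0 i].
Proof.
move=> [[[x0 ax0] [u [c [uc aE]]]] aP].
have uE i : (u *m intmxR R (col i A)) 0 0 = (u *m AR) 0 i.
  by rewrite /intmxR map_col colE mulmxA -colE mxE.
split.
  apply/not_existsP => allon; apply: aP; rewrite aE; apply/seteqP; split=> x; first by case.
  move=> Px; split=> //; have [t [_ t1 ->]] := ConvP Px.
  rewrite mulmxA mxE -[RHS]mulr1 -t1 mulr_sumr; apply: eq_bigr => i _; congr (_ * _).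
  have : lies_on A alpha i by exact: contrapT (allon i).
  by rewrite /lies_on aE -uE => -[].
exists ((c *: l - u) *m AR); split.
- by rewrite -mulmxA gale_mul0 mulmx0.
- move=> i; rewrite /lies_on aE => -[_]; rewrite uE => ui.
  by rewrite mulmxBl -scalemxAl lA !mxE mulr1 -ui mxE subrr.
move=> i nai; rewrite mulmxBl -scalemxAl lA 3!mxE mulr1 mxE subr_gt0 -uE.
rewrite lt_neqAle uc ?andbT; last exact: Conv_col.
apply/negP => /eqP h; apply: nai; rewrite /lies_on aE; split=> //; exact: Conv_col.
Qed.

Lemma gale_relations_on_subface alpha beta :
  proper_face (Conv R A) alpha -> beta `<=` alpha ->
  (~ exists2 L : set 'rV[R]_2, relevant_line B L &
           forall b : 'rV[int]_2, rows_off A B alpha b -> L (intmxR R b)) \/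
  (exists2 L : set 'rV[R]_2, relevant_line B L &
           forall b : 'rV[int]_2, rows_off A B beta b -> L (intmxR R b)) ->
  forall v : 'cV[R]_n, AR *m v = 0 ->
    supported (lies_on A alpha) v -> supported (lies_on A beta) v.
Proof.
move=> pa ba hcond v /gale_kernel[c ->] va.
have [[i nai] [lam [lamB lam0 lam1]]] := proper_face_positive_relation pa.
have rc j : ~ lies_on A alpha j -> (row j BR *m c) 0 0 = 0.
  by move=> naj; rewrite -mulBR; exact: va.
have [->|cn0] := eqVneq c 0; first by move=> j _; rewrite mulmx0 mxE.
case: hcond => [nL|[L [[w wn0 LE] _] bL]]; last first.
  move=> j nbj.
  have off q : ~ lies_on A beta q -> exists s, row q BR = s *: w.
    move=> nq; have : L (intmxR R (row q B)) by apply: bL; exists q.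
    by rewrite LE -row_BR => -[s _ <-]; exists s.
  have [s si] : exists s, row i BR = s *: w.
    by apply: off => bi; apply: nai; exact: ba.
  have sn0 : s != 0.
    by apply: contra (gale_row_neq0 i) => /eqP s0; rewrite si s0 scale0r.
  have wc : (w *m c) 0 0 = 0.
    have := rc _ nai; rewrite si -scalemxAl mxE => /eqP.
    by rewrite mulf_eq0 (negbTE sn0) => /eqP.
  have [t tj] := off _ nbj.
  by rewrite mulBR tj -scalemxAl mxE wc mulr0.
exfalso; apply: nL; have bn0 := gale_row_neq0 i; set b := row i BR in bn0.
have N0 := row2_neq0 bn0.
exists [set t *: b | t in [set: R]]; last first.
  move=> _ [j naj <-]; rewrite -row_BR /=; eexists => //; symmetry.
  exact: parallel_scale (rc _ nai) (rc _ naj).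
split; first by exists b.
(* The positive relation, paired with [b], has a positive term at [i], hence a
   negative one at some [j]: that row is opposite to [b]. *)
pose dot j := b 0 0 * (row j BR) 0 0 + b 0 1 * (row j BR) 0 1.
have lamdot : \sum_j lam 0 j * dot j = 0.
  have h q : \sum_j lam 0 j * (row j BR) 0 q = 0.
    have /matrixP/(_ 0 q) := lamB; rewrite mxE [in RHS]mxE => lq; rewrite -[RHS]lq.
    by apply: eq_bigr => j _; rewrite [in LHS]mxE.
  transitivity (b 0 0 * \sum_j lam 0 j * (row j BR) 0 0 +
                b 0 1 * \sum_j lam 0 j * (row j BR) 0 1); last by rewrite !h !mulr0 addr0.
  by rewrite !mulr_sumr -big_split; apply: eq_bigr => j _; rewrite /dot /=; ring.
have [j [naj dj]] : exists j, ~ lies_on A alpha j /\ dot j < 0.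
  apply/not_existsP => nj.
  have pos j : 0 <= lam 0 j * dot j.
    have [aj|naj] := pselect (lies_on A alpha j); first by rewrite lam0// mul0r.
    rewrite mulr_ge0 ?(ltW (lam1 _ naj))// leNgt; apply/negP => dj.
    exact: nj (conj naj dj).
  have : 0 < lam 0 i * dot i by rewrite mulr_gt0//; exact: lam1.
  rewrite lt_neqAle eq_sym => /andP[/negP + _]; apply.
  move/eqP: lamdot; rewrite psumr_eq0// => /allP/(_ i).
  by rewrite mem_index_enum => /(_ isT).
exists i, j; rewrite -!row_BR -/b; split.
- by exists 1 => //; rewrite scale1r.
- eexists => //; symmetry; exact: parallel_scale (rc _ nai) (rc _ naj).
split=> //; exists (- (dot j / (b 0 0 * b 0 0 + b 0 1 * b 0 1))).
  by rewrite oppr_gt0 pmulr_llt0// invr_gt0.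
rewrite -scaleNr opprK; exact: parallel_scale (rc _ nai) (rc _ naj).
Qed.

End Gale.

Theorem theorem3p6 (R : realType) (n : nat) (hn : (2 <= n)%N)
    (A : 'M[int]_(n - 2, n)) (B : 'M[int]_(n, 2))
    (rankA : \rank (map_mx intr A : 'M[rat]_(n - 2, n)) = (n - 2)%N)
    (homogA : ((const_mx 1 : 'rV[rat]_n) <= (map_mx intr A : 'M[rat]_(n - 2, n)))%MS)
    (galeB : gale_dual A B)
    (rowsB : forall i : 'I_n, row i B != 0)
    (alpha beta : set 'cV[R]_(n - 2))
    (halpha : proper_face (Conv R A) alpha)
    (hbeta : proper_face (Conv R A) beta)
    (hsub : beta `<=` alpha)
    (hcond :
      (~ exists2 L : set 'rV[R]_2, relevant_line B L &
           forall b : 'rV[int]_2, rows_off A B alpha b -> L (intmxR R b)) \/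
      (exists2 L : set 'rV[R]_2, relevant_line B L &
           forall b : 'rV[int]_2, rows_off A B beta b -> L (intmxR R b))) :
  subdiagram_vol A alpha beta = 1%:E /\ face_index A alpha beta = 1%N.
Proof.
have [fa fb] := (halpha.1, hbeta.1).
have [l lA] : exists l : 'rV[R]_(n - 2), l *m intmxR R A = const_mx 1.
  have /submxP[D DA] := homogA; exists (map_mx ratr D).
  by rewrite -map_ratr_intr -map_mxM -DA map_const_mx rmorph1.
have rel := gale_relations_on_subface hn rankA galeB rowsB lA halpha hsub hcond.
split; last exact: face_index1.
exact: (subdiagram_vol1 fa fb hsub rel lA).
Qed.
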